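(* Let $G$ be a finite simple graph with $\Delta(G) \geq 3$. Then \[\chi(G) \leq \max \left\{\omega(G), \Delta_2(G), \frac{5}{6}(\Delta(G) + 1)\right\}.\]
   Context: $\chi(G)$ is the chromatic number, $\omega(G)$ the clique number and $\Delta(G)$ the maximum degree of $G$. $\Delta_2(G)$ (Stacho's parameter) is the largest degree that a vertex $v$ of $G$ can have subject to the condition that $v$ is adjacent to a vertex whose degree is at least as large as the degree of $v$; equivalently, $\Delta_2(G) = \min\{r \geq 0 : \text{the subgraph of } G \text{ induced on the vertices of degree at least } r \text{ is edgeless}\} - 1$. *)

(* Defs.v *)
(* finite simple graphs as symmetric irreflexive relations on a finType. *)
From mathcomp Require Import all_boot all_order all_algebra.
Set Implicit Arguments. Unset Strict Implicit. Unset Printing Implicit Defensive.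

Section Graphs.
Variables (T : finType) (e : rel T).

Definition deg (x : T) : nat := #|[set y | e x y]|.

Definition maxdeg : nat := \max_(x : T) deg x.

Definition is_clique (K : {set T}) : bool :=
  [forall x in K, forall y in K, (x != y) ==> e x y].
Definition clique_number : nat := \max_(K : {set T} | is_clique K) #|K|.

Definition colorable (k : nat) : bool :=
  [exists f : {ffun T -> 'I_k}, [forall x, forall y, e x y ==> (f x != f y)]].
(* least k <= |V| admitting a proper k-colouring (for a loopless graph
   a |V|-colouring always exists, so this is the chromatic number) *)
Definition chromatic_number : nat :=
  \big[minn/#|T|]_(k < #|T|.+1 | colorable k) k.

(* Stacho's Delta_2: largest degree of a vertex v adjacent to a vertex w with
   deg w >= deg v, i.e. the max over edges vw of min(deg v, deg w)
   (0 for an edgeless graph; irrelevant when Delta >= 3). *)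
Definition Delta2 : nat :=
  \max_(x : T) \max_(y : T | e x y) minn (deg x) (deg y).

End Graphs.

(* Main.v *)
Require Import Defs.
From mathcomp Require Import all_boot all_order all_algebra zify.
Set Implicit Arguments. Unset Strict Implicit. Unset Printing Implicit Defensive.

(** Suppose the bound fails; let [n] be one less than the chromatic number and [t]
    the integer part of [n / 5]. Every degree is at most [n + t], the "high"
    vertices, those of degree above [n], are independent, and no clique has [n + 1]
    vertices. Pass to a minimal
    subgraph that is not [n]-colourable and split the [n] colours into [t + 1]
    groups of at least two colours. Colour everything but one vertex, the token,
    which only gets a group, so that few edges run inside the groups. Since a token
    has at most [t] neighbours in excess of the [n] colours, some group is tight
    for it, and by minimality its own group is: it sees each colour of that group
    exactly once. Hence the token can travel through its component in the group,
    and a token of degree at most [n] can also change its group.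

    Let the token leave a group whenever a suitable low neighbour fails to be a
    common neighbour of the token and a low companion of it (Mozhan's walk). The
    first return to a component already left produces exactly the missing common
    neighbour, so the walk ends. Where it ends, the closed neighbourhood of the
    token has [n + 1] vertices, its low vertices are adjacent to all the others,
    and, by Brooks' argument inside a group, each group contains at most one of its
    high vertices. If it is not a clique, two of its high vertices have at most
    [4 t < n] neighbours outside, so they can share a colour, and an [n]-colouring
    results. *)

(** * Connectivity in induced subgraphs *)

Section InducedConnectivity.
Variables (T : finType) (e : rel T).
Hypothesis (e_sym : symmetric e).

Definition induced (A : {set T}) : rel T := [rel u v | [&& e u v, u \in A & v \in A]].

Lemma inducedE A u v : induced A u v = [&& e u v, u \in A & v \in A].
Proof. by []. Qed.

Lemma induced_connect_sym A : connect_sym (induced A).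
Proof. by apply: sym_connect_sym => u v; rewrite !inducedE e_sym [(v \in A) && _]andbC. Qed.

Lemma connect_closed_ind (r : rel T) (X : T -> Prop) u v :
  (forall a b, r a b -> X a -> X b) -> connect r u v -> X u -> X v.
Proof.
move=> clo /connectP[p + ->]; elim: p u => //= a p IH u /andP[ra pth] Xu.
exact: IH pth (clo _ _ ra Xu).
Qed.

Lemma connect_induced_sub (A B : {set T}) u v :
  A \subset B -> connect (induced A) u v -> connect (induced B) u v.
Proof.
move=> /subsetP sAB; move: u v.
suff sub : subrel (induced A) (connect (induced B)) by exact: connect_sub sub.
by move=> a b /and3P[eab aA bA]; apply: connect1; rewrite inducedE eab !sAB.
Qed.

Lemma connect_induced_mem (A : {set T}) u v :
  connect (induced A) u v -> u \in A -> v \in A.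
Proof. by move=> cuv uA; apply: (connect_closed_ind (X := fun w => w \in A) _ cuv uA) => a b /and3P[]. Qed.

(** Confines a walk inside a group to the component in which it runs. *)
Lemma connect_induced_reach (A : {set T}) u v :
  connect (induced A) u v ->
  connect (induced [set w in A | connect (induced A) u w]) u v.
Proof.
move=> cuv.
pose X w := connect (induced A) u w /\
  connect (induced [set w in A | connect (induced A) u w]) u w.
suff [] : X v by [].
apply: (connect_closed_ind (X := X) _ cuv); last by split; apply: connect0.
move=> a b /and3P[eab aA bA] [ca ca'].
have cb : connect (induced A) u b.
  by apply: connect_trans ca _; apply: connect1; rewrite inducedE eab aA.
split=> //; apply: connect_trans ca' _; apply: connect1.
by rewrite inducedE eab !inE aA bA ca cb.
Qed.

End InducedConnectivity.

Definition upd (T : eqType) (A : Type) (f : T -> A) (x : T) (a : A) : T -> A :=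
  fun v => if v == x then a else f v.

Lemma upd_same (T : eqType) A (f : T -> A) x a : upd f x a x = a.
Proof. by rewrite /upd eqxx. Qed.

Lemma upd_other (T : eqType) A (f : T -> A) x a v : v != x -> upd f x a v = f v.
Proof. by rewrite /upd => /negPf->. Qed.

(** * Colourings with one uncoloured vertex *)

Section GroupedColourings.
Variables (T C P : finType) (e : rel T) (g : C -> P).
Hypotheses (e_sym : symmetric e) (e_irr : irreflexive e).

Definition gsize (j : P) : nat := #|[set a | g a == j]|.
Definition cls (p : T -> P) (j : P) : {set T} := [set v | p v == j].
Definition nbc (p : T -> P) (j : P) (v : T) : {set T} := [set w | e v w & p w == j].

(* Moving a vertex from group [i] to group [j] changes this by twice the change of
   its excess (number of neighbours in its group minus size of that group); the
   offset [#|C|] keeps the subtraction from truncating. *)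
Definition potential (p : T -> P) : nat :=
  \sum_u \sum_v (e u v && (p u == p v)) + 2 * \sum_v (#|C| - gsize (p v)).

Lemma eq_potential p q : p =1 q -> potential p = potential q.
Proof.
move=> pq; rewrite /potential; under eq_bigr => u _ do under eq_bigr => v _ do rewrite !pq.
by under [X in _ + 2 * X]eq_bigr => v _ do rewrite pq.
Qed.

Lemma potential_split p x :
  potential p = \sum_(u | u != x) \sum_(v | v != x) (e u v && (p u == p v))
     + 2 * \sum_(v | v != x) (#|C| - gsize (p v))
     + 2 * (#|nbc p (p x) x| + (#|C| - gsize (p x))).
Proof.
rewrite /potential (bigD1 x) //=.
under [X in _ + X + _ = _]eq_bigr => u _ do rewrite (bigD1 x) //=.
rewrite big_split /= [X in 2 * X](bigD1 x) //=.
have -> : \sum_v (e x v && (p x == p v)) = #|nbc p (p x) x|.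
  by rewrite -sum1_card [RHS]big_mkcond; apply: eq_bigr => v _; rewrite inE eq_sym; case: ifP.
have -> : \sum_(i | i != x) (e i x && (p i == p x)) = #|nbc p (p x) x|.
  rewrite -sum1_card [RHS]big_mkcond [RHS](bigD1 x) //= inE e_irr add0n.
  by apply: eq_bigr => v _; rewrite inE e_sym; case: ifP.
lia.
Qed.

Lemma potential_upd p x j :
  potential (upd p x j) + 2 * (#|nbc p (p x) x| + (#|C| - gsize (p x)))
  = potential p + 2 * (#|nbc p j x| + (#|C| - gsize j)).
Proof.
rewrite (potential_split _ x) [potential p](potential_split _ x) upd_same.
have -> : nbc (upd p x j) j x = nbc p j x.
  apply/setP => w; rewrite !inE; case: (eqVneq w x) => [->|wx]; first by rewrite e_irr.
  by rewrite upd_other.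
have -> : \sum_(u | u != x) \sum_(v | v != x) (e u v && (upd p x j u == upd p x j v))
   = \sum_(u | u != x) \sum_(v | v != x) (e u v && (p u == p v)).
  by apply: eq_bigr => u ux; apply: eq_bigr => v vx; rewrite !upd_other.
have -> : \sum_(v | v != x) (#|C| - gsize (upd p x j v))
   = \sum_(v | v != x) (#|C| - gsize (p v)).
  by apply: eq_bigr => u ux; rewrite !upd_other.
lia.
Qed.

(* The token [x] also has a colour [c x], but only its group [g (c x)] matters. *)
Definition proper_off (c : T -> C) (x : T) : Prop :=
  forall u v, u != x -> v != x -> e u v -> c u != c v.

Definition optimal (c : T -> C) (x : T) : Prop :=
  proper_off c x /\
  forall c' x', proper_off c' x' -> potential (g \o c) <= potential (g \o c').

(** Walks inside a component change the colouring but not the partition into groups, so the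
    colouring is hidden. *)
Definition state (p : T -> P) (x : T) : Prop :=
  exists2 c, optimal c x & g \o c =1 p.

Lemma optimal_exists : (exists c x, proper_off c x) -> exists c x, optimal c x.
Proof.
move=> [c0 [x0 v0]].
pose ok (s : {ffun T -> C} * T) := [forall u, forall v,
  (u != s.2) ==> (v != s.2) ==> e u v ==> (s.1 u != s.1 v)].
have okP (s : {ffun T -> C} * T) : reflect (proper_off s.1 s.2) (ok s).
  apply: (iffP idP) => [/forallP h u v ux vx euv|h].
    by have /forallP/(_ v) := h u; rewrite ux vx euv.
  apply/forallP => u; apply/forallP => v.
  by apply/implyP => ux; apply/implyP => vx; apply/implyP => /h; apply.
have ok0 c x : proper_off c x -> ok ([ffun v => c v], x).
  by move=> h; apply/okP => u v ux vx euv; rewrite /= !ffunE; apply: h.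
case: (arg_minnP (fun s : {ffun T -> C} * T => potential (g \o s.1)) (ok0 _ _ v0)).
move=> [c x] /okP /= okc minc; exists c, x; split=> // c' x' /ok0/minc /=.
by rewrite (@eq_potential (g \o [ffun v => c' v]) (g \o c')) // => v; rewrite /= ffunE.
Qed.

(** * Tight groups and moves of the token *)

Hypothesis not_colourable : ~ exists c : T -> C, forall u v, e u v -> c u != c v.
Hypothesis gsize_ge2 : forall j, 2 <= gsize j.
Hypothesis deg_bound : forall x, deg e x < #|C| + #|P|.

(** Otherwise giving [x] the colour [a] would complete a proper colouring. *)
Lemma colour_appears c x a : proper_off c x -> exists2 w, e x w & c w = a.
Proof.
move=> okc; case: (pickP [pred w | e x w & c w == a]) => [w /andP[exw /eqP]|none].
  by exists w.
case: not_colourable; exists (upd c x a) => u v euv.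
have [ux|ux] := eqVneq u x; have [vx|vx] := eqVneq v x.
- by move: euv; rewrite ux vx e_irr.
- rewrite ux upd_same upd_other // eq_sym.
  by apply/negP => cv; move: (none v); rewrite /= -ux euv cv.
- rewrite vx upd_same upd_other //.
  by apply/negP => cu; move: (none u); rewrite /= -vx e_sym euv cu.
- by rewrite !upd_other //; apply: okc.
Qed.

Lemma gsize_le_nbc c x j : proper_off c x -> gsize j <= #|nbc (g \o c) j x|.
Proof.
move=> okc; apply: leq_trans (leq_imset_card c _).
apply/subset_leq_card/subsetP => a; rewrite inE => ga.
have [w exw cw] := colour_appears a okc.
by apply/imsetP; exists w; rewrite // inE exw /= cw.
Qed.

Lemma sum_gsize : \sum_j gsize j = #|C|.
Proof.
rewrite -sum1_card (partition_big g predT) //=; apply: eq_bigr => j _.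
by rewrite /gsize -sum1_card; apply: eq_bigl => a; rewrite !inE.
Qed.

Lemma sum_nbc p x : \sum_j #|nbc p j x| = deg e x.
Proof.
rewrite /deg -sum1_card (partition_big p predT) //=; apply: eq_bigr => j _.
by rewrite -sum1_card; apply: eq_bigl => a; rewrite !inE.
Qed.

(** If [gsize] were exceeded in every group, the degree would be at least [#|C| + #|P|]. *)
Lemma tight_group c x : proper_off c x -> exists j, #|nbc (g \o c) j x| = gsize j.
Proof.
move=> okc; case: (pickP [pred j | #|nbc (g \o c) j x| == gsize j]) => [j /eqP|none].
  by exists j.
have := deg_bound x; rewrite -(sum_nbc (g \o c)) -sum_gsize.
suff : \sum_j (gsize j + 1) <= \sum_j #|nbc (g \o c) j x|.
  by rewrite big_split /= sum1_card ltnNge => ->.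
apply: leq_sum => j _; rewrite addn1 ltn_neqAle gsize_le_nbc // andbT eq_sym.
by apply/negbT; apply: none.
Qed.

Lemma low_tight c x j :
  proper_off c x -> deg e x <= #|C| -> #|nbc (g \o c) j x| = gsize j.
Proof.
move=> okc low; apply/eqP; rewrite eqn_leq gsize_le_nbc // andbT leqNgt.
apply/negP => gt; move: low; rewrite -(sum_nbc (g \o c)) -sum_gsize leqNgt => /negP; apply.
rewrite (bigD1 j) //= [X in _ < X](bigD1 j) //= -addSn; apply: leq_add => //.
by apply: leq_sum => i _; apply: gsize_le_nbc.
Qed.

Lemma proper_off_upd (c : T -> C) x a : proper_off c x -> proper_off (upd c x a) x.
Proof. by move=> okc u v ux vx; rewrite !upd_other //; apply: okc. Qed.

Lemma comp_upd (c : T -> C) x a : g \o upd c x a =1 upd (g \o c) x (g a).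
Proof. by move=> v; rewrite /= /upd /=; case: ifP. Qed.

Lemma group_colour j : exists a, g a = j.
Proof.
have : 0 < gsize j by apply: leq_trans (gsize_ge2 j).
by rewrite card_gt0 => /set0Pn[a]; rewrite inE => /eqP; exists a.
Qed.

Lemma gsize_le j : gsize j <= #|C|.
Proof. exact: max_card. Qed.

(** A move to a tight group makes the excess of the token 0 and cannot lower the potential, so the
    excess was not positive before. *)
Lemma optimal_tight c x :
  optimal c x -> #|nbc (g \o c) (g (c x)) x| = gsize (g (c x)).
Proof.
move=> [okc minc]; have [j tj] := tight_group okc; have [a ga] := group_colour j.
have := minc _ _ (proper_off_upd a okc).
rewrite (eq_potential (comp_upd c x a)) ga.
have := potential_upd (g \o c) x j; rewrite tj -[(g \o c) x]/(g (c x)).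
have := gsize_le_nbc (g (c x)) okc; have := gsize_le j; have := gsize_le (g (c x)).
lia.
Qed.

Lemma optimal_recolour (c : T -> C) x a :
  optimal c x -> #|nbc (g \o c) (g a) x| = gsize (g a) -> optimal (upd c x a) x.
Proof.
move=> opt ta; have [okc minc] := opt; split; first exact: proper_off_upd.
move=> c' x' /minc; apply: leq_trans; rewrite (eq_potential (comp_upd c x a)).
have := potential_upd (g \o c) x (g a).
rewrite ta -[(g \o c) x]/(g (c x)) (optimal_tight opt).
have := gsize_le (g a); have := gsize_le (g (c x)); lia.
Qed.

(** The token has as many neighbours in its group as the group has colours, and each colour occurs,
    so none occurs twice. *)
Lemma optimal_nbr_inj c x u v : optimal c x -> e x u -> e x v ->
  g (c u) = g (c x) -> c u = c v -> u = v.
Proof.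
move=> opt exu exv gu cuv; have [okc _] := opt.
set N := nbc (g \o c) (g (c x)) x.
suff inj : {in N &, injective c}.
  by apply: inj => //; rewrite inE ?exu ?exv /= ?gu // -cuv gu.
apply/imset_injP; rewrite eqn_leq leq_imset_card /= (optimal_tight opt) /gsize.
apply/subset_leq_card/subsetP => a; rewrite inE => ga.
have [w exw cw] := colour_appears a okc.
by apply/imsetP; exists w; rewrite // inE exw /= cw.
Qed.

(** Both vertices lie in one group, so the potential is unchanged; [x] can take the colour of [y],
    its only neighbour of that colour. *)
Lemma optimal_transfer (c : T -> C) x y : optimal c x -> e x y -> g (c y) = g (c x) ->
  optimal (upd c x (c y)) y.
Proof.
move=> opt exy gy; have [okc minc] := opt; have xy : y != x.
  by apply: contraTneq exy => ->; rewrite e_irr.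
split.
  have aux v : v != y -> v != x -> e x v -> c y != c v.
    move=> vy vx exv; apply: contra vy => /eqP cv.
    by rewrite (optimal_nbr_inj opt exy exv gy cv).
  move=> u v uy vy euv; have [ux|ux] := eqVneq u x; have [vx|vx] := eqVneq v x.
  - by move: euv; rewrite ux vx e_irr.
  - by rewrite ux in euv *; rewrite upd_same upd_other //; apply: aux.
  - by rewrite vx e_sym in euv *; rewrite upd_same upd_other // eq_sym; apply: aux.
  - by rewrite !upd_other //; apply: okc.
move=> c' x' /minc; rewrite (eq_potential (comp_upd c x (c y))).
rewrite (@eq_potential (upd _ _ _) (g \o c)) // => v.
by rewrite /upd; case: eqP => // ->.
Qed.

(* A step of the token from [a] to [b] gives [a] the colour of [b]; properness
   survives because [b] is the only neighbour of [a] with that colour. *)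
Lemma token_walk c x v (A : {set T}) : optimal c x -> A \subset cls (g \o c) (g (c x)) ->
  x \in A -> connect (induced e A) x v ->
  exists c', [/\ optimal c' v, g \o c' =1 g \o c & forall w, w \notin A -> c' w = c w].
Proof.
move=> opt /subsetP sA xA cxv.
pose X v := v \in A /\ exists c',
  [/\ optimal c' v, g \o c' =1 g \o c & forall w, w \notin A -> c' w = c w].
suff [] : X v by [].
apply: (connect_closed_ind (X := X) _ cxv); last by split=> //; exists c.
move=> a b /and3P[eab aA bA] [_ [c' [opt' gc' cA]]]; split=> //.
have ga w : w \in A -> g (c' w) = g (c x).
  by move=> /sA; rewrite inE => /eqP <-; apply: gc'.
have gab : g (c' b) = g (c' a) by rewrite !ga.
exists (upd c' a (c' b)); split; first exact: optimal_transfer.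
- by move=> w; rewrite -gc' /= /upd; case: eqP => // ->.
- move=> w wA; rewrite upd_other ?cA //; by apply: contraNneq wA => ->.
Qed.


(* [u] is the neighbour of [z] with the colour of [w]. A walk from [w] to [z]
   avoiding [x] and [u] would carry the token from [x] via [w] to [z] and leave [z]
   with two neighbours, [x] and [u], of that colour. *)
Lemma separator c x w z : optimal c x -> e x w -> e x z ->
  g (c w) = g (c x) -> g (c z) = g (c x) -> w != z -> ~~ e w z ->
  exists u, [/\ e z u, c u = c w, u != x &
    ~~ connect (induced e (cls (g \o c) (g (c x)) :\ x :\ u)) w z].
Proof.
move=> opt exw exz gw gz wz nwz.
have wx : w != x by apply: contraTneq exw => ->; rewrite e_irr.
have zx : z != x by apply: contraTneq exz => ->; rewrite e_irr.
have [okz _] := optimal_transfer opt exz gz.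
have [u ezu cu'] := colour_appears (c w) okz.
have ux : u != x.
  apply: contra wz => /eqP ux; move: cu'; rewrite ux upd_same => czw.
  by rewrite (optimal_nbr_inj opt exz exw gz czw).
have cu : c u = c w by rewrite -cu' upd_other.
exists u; split=> //; apply/negP => cwz.
have wu : w != u by apply: contraNneq nwz => ->; rewrite e_sym.
have optw := optimal_transfer opt exw gw.
set A := _ :\ u in cwz.
have sA : A \subset cls (g \o upd c x (c w)) (g (upd c x (c w) w)).
  apply/subsetP => v; rewrite !inE => /and3P[_ vx /eqP gv] /=.
  by rewrite !upd_other // gw; apply/eqP.
have wA : w \in A by rewrite !inE wu wx /= gw eqxx.
have [c3 [opt3 g3 c3A]] := token_walk optw sA wA cwz.
have c3x : c3 x = c w by rewrite c3A ?upd_same // !inE eqxx andbF.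
have c3u : c3 u = c w by rewrite c3A ?upd_other // !inE eqxx.
have g3z : g (c3 z) = g (c x) by have /= -> := g3 z; rewrite upd_other.
have ezx : e z x by rewrite e_sym.
have g3x : g (c3 x) = g (c3 z) by rewrite c3x g3z.
have c3xu : c3 x = c3 u by rewrite c3x.
by rewrite (optimal_nbr_inj opt3 ezx ezu g3x c3xu) eqxx in ux.
Qed.

(** Otherwise swap the colours of [y] and [z] on the component of [y], taken in the whole group
    minus the token. Then no neighbour of [x] has colour [c y], against [colour_appears]. *)
Lemma kempe_connect c x y z : optimal c x -> e x y -> e x z ->
  g (c y) = g (c x) -> g (c z) = g (c x) ->
  connect (induced e (cls (g \o c) (g (c x)) :\ x)) y z.
Proof.
move=> opt exy exz gy gz; have [okc _] := opt.
set A := _ :\ x; apply/negP => /negP ncyz.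
have yA : y \in A.
  by rewrite !inE /= gy eqxx andbT; apply: contraTneq exy => ->; rewrite e_irr.
pose D v := connect (induced e A) y v.
pose sw k := if k == c y then c z else if k == c z then c y else k.
have swK : involutive sw.
  move=> k; rewrite /sw; case: (eqVneq k (c y)) => [->|ky].
    by case: eqVneq => [->|//]; rewrite ?eqxx.
  by case: (eqVneq k (c z)) => [->|/negPf->]; rewrite ?eqxx // (negPf ky).
have gsw k : g (sw k) = g k.
  by rewrite /sw; case: eqP => [->|_]; [rewrite gy|case: eqP => // ->; rewrite gy].
pose c' v := if D v then sw (c v) else c v.
have DA v : D v -> v \in A by move=> Dv; apply: connect_induced_mem Dv yA.
have half u v : u != x -> v != x -> e u v -> D u -> ~~ D v -> c' u != c' v.
  move=> ux vx euv Du nDv; have c'v : c' v = c v by rewrite /c' (negPf nDv).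
  have c'u : g (c' u) = g (c u) by rewrite /c' Du gsw.
  have uA := DA _ Du; rewrite c'v; apply: contra nDv => /eqP cuv; apply: connect_trans Du _; apply: connect1.
  by rewrite inducedE euv uA; move: uA; rewrite !in_setD1 ux vx !inE /= -cuv c'u.
have okc' : proper_off c' x.
  move=> u v ux vx euv; have [Du|nDu] := boolP (D u); have [Dv|nDv] := boolP (D v).
  - by rewrite /c' Du Dv (inj_eq (inv_inj swK)); apply: okc.
  - exact: half.
  - by rewrite eq_sym; apply: half; rewrite // e_sym.
  - by rewrite /c' (negPf nDu) (negPf nDv); apply: okc.
have [w exw] := colour_appears (c y) okc'; rewrite /c'; case: ifP => Dw cw.
  have cw2 : c w = c z by rewrite -[c w]swK cw /sw eqxx.
  have wz := optimal_nbr_inj opt exz exw gz (esym cw2).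
  by move: ncyz; rewrite wz; apply/negP/negPn.
have wy := optimal_nbr_inj opt exy exw gy (esym cw).
by move: Dw; rewrite -wy /D connect0.
Qed.

(** If [a] cut off [w] from [z], follow the walk from [w] to [z] given by [kempe_connect]. It cannot
    meet [a], which would link [w] to [z] off their separator [b], nor [b], which is adjacent to
    [z]; so it never reaches [z]. *)
Lemma separator_same_side c x y z w a (A := cls (g \o c) (g (c x)) :\ x) :
  optimal c x -> e x y -> e x z -> e x w ->
  g (c y) = g (c x) -> g (c z) = g (c x) -> g (c w) = g (c x) ->
  w != y -> w != z -> e z a -> c a = c y -> a != x ->
  ~~ connect (induced e (A :\ a)) y z -> connect (induced e (A :\ a)) w z.
Proof.
move=> opt exy exz exw gy gz gw wy wz eza ca ax sep.
have neqx v : e x v -> v != x by move=> exv; apply: contraTneq exv => ->; rewrite e_irr.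
have inA a' v : (v \in A :\ a') = (v != a') && (v \in A) by rewrite in_setD1.
have zA : z \in A by rewrite !inE neqx //= gz.
have wA : w \in A by rewrite !inE neqx //= gw.
have aA : a \in A by rewrite !inE ax /= ca gy.
have wa : w != a.
  by apply: contra wy => /eqP wa; rewrite (optimal_nbr_inj opt exw exy gw) // wa.
have za : z != a by apply: contraTneq eza => <-; rewrite e_irr.
have [ewz|nwz] := boolP (e w z).
  by apply: connect1; rewrite inducedE ewz !inA wa wA za zA.
have [b [ezb cb bx sepb]] := separator opt exw exz gw gz wz nwz.
have bA : b \in A by rewrite !inE bx /= cb gw.
have ba : b != a.
  by apply: contra wy => /eqP ba; rewrite (optimal_nbr_inj opt exw exy gw) // -cb ba.
have zb : z != b by apply: contraTneq ezb => <-; rewrite e_irr.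
have wb : w != b by apply: contraNneq nwz => ->; rewrite e_sym.
rewrite -/A in sepb; apply/negP => /negP nwz'.
pose X v := [/\ ~~ connect (induced e (A :\ a)) z v, v != a & connect (induced e (A :\ b)) w v].
suff [] : X z by rewrite connect0.
have nzb : connect (induced e (A :\ a)) z b.
  by apply: connect1; rewrite inducedE ezb !inA ba bA za zA.
apply: (connect_closed_ind (X := X) _ (kempe_connect opt exw exz gw gz)); last first.
  by split; rewrite ?connect0 // (induced_connect_sym e_sym).
move=> s t /and3P[est sA tA] [nzs sa cws].
have sb : s \in A :\ b by apply: (connect_induced_mem cws); rewrite inA wb wA.
have ta : t != a.
  apply/negP => /eqP ta; case/negP: sepb; apply: connect_trans cws _.
  apply: (@connect_trans _ _ a); apply: connect1; rewrite inducedE.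
    by rewrite sb -ta est inA tA ta eq_sym ba.
  by rewrite e_sym eza !inA aA zA zb eq_sym ba.
have nzt : ~~ connect (induced e (A :\ a)) z t.
  apply: contra nzs => czt; apply: connect_trans czt _; apply: connect1.
  by rewrite inducedE e_sym est !inA ta tA sa sA.
split=> //; apply: connect_trans cws _; apply: connect1.
rewrite inducedE est sb inA tA andbT; apply: contra nzt => /eqP->; exact: nzb.
Qed.

(* The two vertices [a] and [b] separating [y] from [z] cannot coexist with a third
   neighbour [w] of [x] lying on the side of [z] of the first one and on the side of
   [y] of the second one. *)
Lemma brooks_nbrs c x y z : optimal c x -> 3 <= gsize (g (c x)) -> e x y -> e x z ->
  g (c y) = g (c x) -> g (c z) = g (c x) -> y != z -> e y z.
Proof.
move=> opt r3 exy exz gy gz yz; apply/negP => /negP nyz; have [okc _] := opt.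
have neqx v : e x v -> v != x by move=> exv; apply: contraTneq exv => ->; rewrite e_irr.
(* A third colour of the group provides a third neighbour. *)
have [w [exw gw wy wz]] : exists w, [/\ e x w, g (c w) = g (c x), w != y & w != z].
  have : 0 < #|[set a | g a == g (c x)] :\ c y :\ c z|.
    have := cardsD1 (c y) [set a | g a == g (c x)].
    have := cardsD1 (c z) ([set a | g a == g (c x)] :\ c y).
    by move: r3; rewrite /gsize; case: (_ \in _); case: (_ \in _); lia.
  rewrite card_gt0 => /set0Pn[k]; rewrite !inE => /and3P[kz ky /eqP gk].
  have [w exw cw] := colour_appears k okc; exists w; rewrite cw; split=> //.
    by apply: contra ky => /eqP <-; rewrite cw.
  by apply: contra kz => /eqP <-; rewrite cw.
have zy : z != y by rewrite eq_sym.
have nzy : ~~ e z y by rewrite e_sym.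
have [a [eza ca ax sepa]] := separator opt exy exz gy gz yz nyz.
have [b [eyb cb bx sepb]] := separator opt exz exy gz gy zy nzy.
have h1 := separator_same_side opt exy exz exw gy gz gw wy wz eza ca ax sepa.
have h2 := separator_same_side opt exz exy exw gz gy gw wz wy eyb cb bx sepb.
set A := _ :\ x in sepa sepb h1 h2.
have inA a' v : (v \in A :\ a') = (v != a') && (v \in A) by rewrite in_setD1.
have zA : z \in A by rewrite !inE neqx //= gz.
have yA : y \in A by rewrite !inE neqx //= gy.
have za : z != a by apply: contraTneq eza => <-; rewrite e_irr.
have yb : y != b by apply: contraTneq eyb => <-; rewrite e_irr.
have zb : z != b by apply: contraNneq nyz => ->.
(* The walk from [w] to [y] off [b] could leave the side of [z] only through [a]; but [a] is
   adjacent to [z], so [y] would be linked to [z] off [b]. *)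
pose X v := connect (induced e (A :\ a)) z v /\ connect (induced e (A :\ b)) y v.
suff [czy _] : X y by case/negP: sepa; rewrite induced_connect_sym.
apply: (connect_closed_ind (X := X) _ h2); last first.
  by split; rewrite induced_connect_sym.
move=> s t /and3P[est sA tA] [czs cys].
have cyt : connect (induced e (A :\ b)) y t.
  by apply: connect_trans cys _; apply: connect1; rewrite inducedE est sA.
have sA' : s \in A :\ a by apply: (connect_induced_mem czs); rewrite inA za zA.
split=> //; apply: connect_trans czs _; apply: connect1.
rewrite inducedE est sA' inA; move: (tA); rewrite inA => /andP[_ ->].
rewrite andbT; apply/negP => /eqP ta; case/negP: sepb.
rewrite induced_connect_sym //; apply: connect_trans cyt _; apply: connect1.
by rewrite inducedE tA inA zA zb ta e_sym eza.
Qed.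

Definition comp p x : {set T} := [set v | connect (induced e (cls p (p x))) x v].

Lemma nbc_ext p q j x : p =1 q -> nbc p j x = nbc q j x.
Proof. by move=> pq; apply/setP => v; rewrite !inE pq. Qed.

Lemma cls_ext p q j : p =1 q -> cls p j = cls q j.
Proof. by move=> pq; apply/setP => v; rewrite !inE pq. Qed.

Lemma state_tight p x : state p x -> #|nbc p (p x) x| = gsize (p x).
Proof.
by move=> [c opt cp]; have := optimal_tight opt; rewrite (nbc_ext _ _ cp) -(cp x).
Qed.

Lemma state_low_tight p x j :
  state p x -> deg e x <= #|C| -> #|nbc p j x| = gsize j.
Proof. by move=> [c [okc _] cp] low; rewrite -(nbc_ext _ _ cp) low_tight. Qed.

Lemma state_upd p x j : state p x -> deg e x <= #|C| -> state (upd p x j) x.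
Proof.
move=> [c opt cp] low; have [a ga] := group_colour j.
exists (upd c x a).
  by apply: optimal_recolour => //; apply: low_tight => //; case: opt.
by move=> v; rewrite comp_upd ga /upd; case: ifP.
Qed.

Lemma mem_comp_class p x v : v \in comp p x -> p v = p x.
Proof.
rewrite inE => /connect_induced_mem h; apply/eqP.
by have := h; rewrite !inE eqxx; apply.
Qed.

Lemma comp_refl p x : x \in comp p x.
Proof. by rewrite inE connect0. Qed.

Lemma comp_trans p x u v : u \in comp p x -> e u v -> p v = p x -> v \in comp p x.
Proof.
move=> ux euv pv; have pu := mem_comp_class ux; move: ux; rewrite !inE => cxu.
by apply: connect_trans cxu _; apply: connect1; rewrite inducedE euv !inE pu pv eqxx.
Qed.

Lemma comp_eq p x y : y \in comp p x -> comp p y = comp p x.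
Proof.
move=> yx; have py := mem_comp_class yx; apply/setP => v; move: yx; rewrite !inE py => cxy.
by rewrite (same_connect (induced_connect_sym e_sym _) cxy).
Qed.

Lemma state_move p x y : state p x -> y \in comp p x -> state p y.
Proof.
move=> [c opt cp]; rewrite inE -(cls_ext _ cp) -(cp x) => cxy.
have [|c' [opt' gc' _]] := token_walk opt (subxx _) _ cxy; first by rewrite inE.
by exists c' => // v; rewrite gc' cp.
Qed.

Lemma state_kempe p x y z : state p x -> e x y -> e x z -> p y = p x -> p z = p x ->
  connect (induced e (cls p (p x) :\ x)) y z.
Proof.
move=> [c opt cp] exy exz py pz; rewrite -(cls_ext _ cp) -(cp x).
by apply: kempe_connect => //; have /= := cp x; have /= := cp y; have /= := cp z; congruence.
Qed.

Lemma state_brooks p x y z : state p x -> 3 <= gsize (p x) -> e x y -> e x z ->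
  p y = p x -> p z = p x -> y != z -> e y z.
Proof.
move=> [c opt cp] r3 exy exz py pz.
apply: (@brooks_nbrs c x) => //; have /= := cp x; have /= := cp y; have /= := cp z; congruence.
Qed.

(** A walk leaving [x] passes through a neighbour of [x], and [state_kempe] joins these neighbours
    off [x]: the token is no cut vertex. *)
Lemma state_comp_connect p x u v : state p x -> u \in comp p x :\ x -> v \in comp p x :\ x ->
  connect (induced e (comp p x :\ x)) u v.
Proof.
move=> st.
have reach w : w \in comp p x -> w != x ->
    exists y, [/\ e x y, p y = p x & connect (induced e (cls p (p x) :\ x)) y w].
  rewrite inE => cxw.
  pose X w := w = x \/
    exists y, [/\ e x y, p y = p x & connect (induced e (cls p (p x) :\ x)) y w].
  suff : X w by move=> [->|//]; rewrite eqxx.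
  apply: (connect_closed_ind (X := X) _ cxw); last by left.
  move=> a b /and3P[eab aA bA] [ax|[y [exy py cya]]].
    by right; exists b; move: bA; rewrite inE => /eqP; rewrite -ax; split; rewrite ?connect0.
  have [->|bx] := eqVneq b x; [by left|right; exists y; split=> //].
  have yx : y != x by apply: contraTneq exy => ->; rewrite e_irr.
  have aA' : a \in cls p (p x) :\ x by apply: (connect_induced_mem cya); rewrite !inE yx py /=.
  by apply: connect_trans cya _; apply: connect1; rewrite inducedE eab aA' in_setD1 bx.
rewrite !in_setD1 => /andP[ux uc] /andP[vx vc].
have [y [exy py cyu]] := reach u uc ux; have [z [exz pz czv]] := reach v vc vx.
have cuv : connect (induced e (cls p (p x) :\ x)) u v.
  rewrite induced_connect_sym // in cyu.
  exact: connect_trans cyu (connect_trans (state_kempe st exy exz py pz) czv).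
apply: connect_induced_sub (connect_induced_reach cuv).
apply/subsetP => w; rewrite in_set => /andP[wA cuw]; move: wA.
rewrite !in_setD1 => /andP[-> _] /=.
have : connect (induced e (cls p (p x))) u w by apply: connect_induced_sub cuw; apply: subsetDl.
by move: uc; rewrite !in_set; apply: connect_trans.
Qed.

(** * The walk of the token *)

Hypothesis high_independent :
  forall u v, e u v -> (deg e u <= #|C|) || (deg e v <= #|C|).

(* Otherwise the component of the token is bipartite (low against high) and could
   be coloured with two colours of its group. *)
Lemma state_low_edge p x : state p x -> exists u v,
  [/\ u \in comp p x, v \in comp p x, e u v, deg e u <= #|C| & deg e v <= #|C|].
Proof.
move=> [c [okc _] cp].
case: (pickP [pred s : T * T | [&& s.1 \in comp p x, s.2 \in comp p x, e s.1 s.2,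
    deg e s.1 <= #|C| & deg e s.2 <= #|C|]]) => [[u v] /and5P[]|none]; first by exists u, v.
have /card_gt1P[a [b [+ + ab]]] := gsize_ge2 (p x); rewrite !inE => /eqP ga /eqP gb.
pose c' v := if v \in comp p x then if deg e v <= #|C| then a else b else c v.
case: not_colourable; exists c'.
have half u v : e u v -> u \in comp p x -> v \notin comp p x -> c' u != c' v.
  move=> euv uc nvc; rewrite /c' uc (negPf nvc).
  have : p v <> p x by move=> pv; case/negP: nvc; apply: comp_trans uc euv pv.
  rewrite -(cp v) /= => pv; apply/eqP => cuv; apply: pv; rewrite -cuv.
  by case: ifP.
move=> u v euv; have [uc|nuc] := boolP (u \in comp p x); have [vc|nvc] := boolP (v \in comp p x).
- have := none (u, v); have := high_independent euv; rewrite /= /c' uc vc euv.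
  by case: (_ <= _) => //=; case: (_ <= _) => //= _ _; rewrite eq_sym.
- exact: half.
- by rewrite eq_sym; apply: half; rewrite // e_sym.
- rewrite /c' (negPf nuc) (negPf nvc); apply: okc => //.
    by apply: contraNneq nuc => ->; apply: comp_refl.
  by apply: contraNneq nvc => ->; apply: comp_refl.
Qed.

Definition low x := deg e x <= #|C|.

(* Both tokens being tight, [v] has equally many neighbours in the group of either token. *)
Lemma compare_tokens p x q y v : state p x -> state q y -> p x = q y ->
  x != y -> v \in comp p x -> v \in comp q y ->
  (forall w, w != x -> w != y -> e v w -> (p w == p x) = (q w == p x)) ->
  (e v y -> p y != p x) -> (e v x -> q x != p x) -> e v x = e v y.
Proof.
move=> stp stq pq xy vp vq same py qx.
have := state_tight (state_move stp vp); have := state_tight (state_move stq vq).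
rewrite (mem_comp_class vp) (mem_comp_class vq) -pq => <-.
rewrite (cardsD1 x) [in RHS](cardsD1 y) !inE pq !eqxx !andbT -pq.
suff -> : nbc p (p x) v :\ x = nbc q (p x) v :\ y.
  by move/eqP; rewrite eqn_add2r; case: (e v x); case: (e v y).
apply/setP => w; rewrite !inE; have [evw|] := boolP (e v w); last by rewrite !andbF.
have [wx|wx] := eqVneq w x; have [wy|wy] := eqVneq w y => //=; try exact: same.
  by rewrite wx (negPf (qx _)) // -wx.
by rewrite wy (negPf (py _)) // -wy.
Qed.

(* With [x], or with [y], as the token of the group of [z], the neighbours of the
   token in that group lie in one component, and the same one because of [z]; in
   it they are the vertices whose degree is one short of the group size. *)
Lemma common_nbr_class p x y z v : state p x -> low x -> low y -> e x y ->
  p z != p y -> e x z -> e y z -> v != x -> p v = p z -> e y v = e x v.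
Proof.
move=> st lx ly exy zy exz eyz vx pv.
have yx : y != x by apply: contraTneq exy => ->; rewrite e_irr.
have zx : z != x by apply: contraTneq exz => ->; rewrite e_irr.
have zy' : z != y by apply: contraTneq eyz => ->; rewrite e_irr.
have vy : v != y by apply: contra_neq zy => vy; rewrite -pv vy.
pose p1 := upd p x (p y); pose p2 := upd p1 y (p z); pose p3 := upd p x (p z).
have st1 : state p1 x by apply: state_upd.
have p1x : p1 x = p y by rewrite /p1 upd_same.
have st1y : state p1 y.
  by apply: (state_move st1); apply: comp_trans (comp_refl _ _) exy _; rewrite p1x /p1 upd_other.
have st2 : state p2 y by apply: state_upd.
have st3 : state p3 x by apply: state_upd.
have p2y : p2 y = p z by rewrite /p2 upd_same.
have p3x : p3 x = p z by rewrite /p3 upd_same.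
have p2x : p2 x = p y by rewrite /p2 upd_other // eq_sym.
have p2o w : w != x -> w != y -> p2 w = p w by move=> wx wy; rewrite /p2 /p1 !upd_other.
have p3o w : w != x -> p3 w = p w by move=> wx; rewrite /p3 !upd_other.
have main : v \in comp p2 y -> v \in comp p3 x -> e y v = e x v.
  move=> v2 v3; rewrite e_sym [RHS]e_sym; apply: (compare_tokens st2 st3) => //.
  - by rewrite p2y p3x.
  - by move=> w wy wx _; rewrite p2o ?p3o.
  - by rewrite p2x p2y eq_sym.
  - by rewrite p3o // p2y eq_sym.
have z2 : z \in comp p2 y by apply: comp_trans (comp_refl _ _) eyz _; rewrite p2o // p2y.
have z3 : z \in comp p3 x by apply: comp_trans (comp_refl _ _) exz _; rewrite p3o // p3x.
apply/idP/idP => [eyv|exv].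
  rewrite -main //; first by apply: comp_trans (comp_refl _ _) eyv _; rewrite p2o // p2y.
  have := state_kempe st2 eyz eyv; rewrite p2y !p2o // => /(_ erefl pv) czv.
  move: z3; rewrite !inE p3x => cxz; apply: connect_trans cxz _.
  apply: connect_induced_sub czv; apply/subsetP => w; rewrite !inE => /andP[wy].
  have [->|wx] := eqVneq w x; first by rewrite p3x.
  by rewrite p2o // p3o.
rewrite main //; last by apply: comp_trans (comp_refl _ _) exv _; rewrite p3o // p3x.
have := state_kempe st3 exz exv; rewrite p3x !p3o // => /(_ erefl pv) czv.
move: z2; rewrite !inE p2y => cyz; apply: connect_trans cyz _.
apply: connect_induced_sub czv; apply/subsetP => w; rewrite !inE => /andP[wx].
have [->|wy] := eqVneq w y; first by rewrite p2y.
by rewrite p2o // p3o.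
Qed.

Section Walk.
(** At time [s] the token [x s], with low companion [z s], moves to the group [j s] and hands over
    to [x s.+1] there. *)
Variables (p : nat -> T -> P) (x z : nat -> T) (N : nat).
Hypothesis walk_state : forall s, s <= N -> state (p s) (x s).
Hypothesis walk_low : forall s, s <= N -> low (x s) /\ low (z s).
Hypothesis walk_edge : forall s, s <= N -> e (x s) (z s) /\ p s (z s) = p s (x s).
Let j s := p s.+1 (x s).
Hypothesis walk_step : forall s, s < N -> p s.+1 = upd (p s) (x s) (j s).
Hypothesis walk_leave : forall s, s < N -> j s != p s (x s).
Hypothesis walk_next : forall s, s < N -> x s.+1 \in comp (p s.+1) (x s) :\ x s.
Hypothesis walk_bad : forall s y, s < N ->
  low y -> p s y = j s -> e (x s) y -> e (z s) y -> False.

(** What the token leaves behind at time [s], and what it joins. *)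
Let F s := comp (p s) (x s) :\ x s.
Let A s := comp (p s.+1) (x s) :\ x s.

Lemma walk_comp s : s < N -> comp (p s.+1) (x s.+1) = comp (p s.+1) (x s).
Proof. by move=> sN; apply: comp_eq; have := walk_next sN; rewrite in_setD1 => /andP[]. Qed.

Lemma walk_group s : s < N -> p s.+1 (x s.+1) = j s.
Proof. by move=> /walk_next; rewrite in_setD1 => /andP[_ /mem_comp_class]. Qed.

Lemma walk_other s v : s < N -> v != x s -> p s.+1 v = p s v.
Proof. by move=> sN vx; rewrite walk_step // upd_other. Qed.

Lemma walk_prev s : s < N -> x s \in F s.+1.
Proof.
move=> sN; have := walk_next sN; rewrite !in_setD1 => /andP[nx _].
by rewrite eq_sym nx walk_comp //= comp_refl.
Qed.

(** The abandoned component survives at time [s]: it has lost no vertex and gained no neighbour in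
    its group. *)
Definition intact q s := (forall v, v \in F q -> p s v = p q (x q)) /\
  (forall u v, u \in F q -> e u v -> p s v = p q (x q) -> v \in F q).

Lemma intact_next q : q < N -> intact q q.+1.
Proof.
move=> qN; split=> [v|u v].
  by rewrite in_setD1 => /andP[vx vc]; rewrite walk_other // (mem_comp_class vc).
rewrite !in_setD1 => /andP[ux uc] euv pv.
have vx : v != x q by apply/negP => /eqP vx; move: (walk_leave qN); rewrite /j -pv vx eqxx.
by rewrite vx; apply: comp_trans uc euv _; rewrite -(walk_other qN vx).
Qed.

(** Only [x s] changes group. If it joins the group of [F q], its neighbours there lie in [A s],
    hence outside [F q]. *)
Lemma intact_step q s : s < N -> x s \notin F q ->
  (j s = p q (x q) -> forall v, v \in A s -> v \notin F q) -> intact q s -> intact q s.+1.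
Proof.
move=> sN xF disj [i1 i2]; split=> [v vF|u v uF euv].
  by rewrite walk_other ?i1 //; apply: contraNneq xF => <-.
have [vx|vx] := eqVneq v (x s).
  rewrite vx => js; have ux : u != x s by apply: contraNneq xF => <-.
  have uA : u \in A s.
    rewrite in_setD1 ux; apply: comp_trans (comp_refl _ _) _ _; first by rewrite -vx e_sym.
    by rewrite walk_other // i1 // js.
  by move: (disj js u uA); rewrite uF.
by rewrite walk_other //; apply: i2 uF euv.
Qed.

Section FirstReturn.
Variable m : nat.
Hypothesis mN : m < N.
Hypothesis no_return : forall s q v, s < m -> q <= s -> v \in A s -> v \notin F q.

Lemma fresh_token q s : q < s -> s <= m -> x s \notin F q.
Proof.
case: s => // s qs sm; apply: (no_return (s := s)) => //.
by apply: walk_next; apply: leq_trans sm (ltnW mN).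
Qed.

Lemma intact_before q s : q < s -> s <= m -> intact q s.
Proof.
elim: s => // s IH; rewrite ltnS leq_eqVlt => /orP[/eqP<- sm|qs sm].
  by apply: intact_next; apply: leq_trans sm (ltnW mN).
apply: intact_step.
- exact: leq_trans sm (ltnW mN).
- exact: fresh_token qs (ltnW sm).
- by move=> _ v; apply: no_return => //; apply: ltnW.
- exact: IH qs (ltnW sm).
Qed.

(* When the token comes back to the component [F q] it left at time [q], it can go
   to [z q] and follow the former token [x q] into the group [j q]; counting
   neighbours there makes [x q.+1] adjacent to both [x q] and [z q], contrary to
   [walk_bad]. *)
Lemma no_first_return q v : q <= m -> v \in A m -> v \in F q -> False.
Proof.
move=> qm vA vF.
have [vx vc] : v != x m /\ v \in comp (p m.+1) (x m) by apply/andP; rewrite -in_setD1.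
have pv : p m.+1 v = j m by rewrite (mem_comp_class vc).
move: qm; rewrite leq_eqVlt => /orP[/eqP qm|qm].
  move: vF; rewrite qm in_setD1 => /andP[_ /mem_comp_class pv'].
  by have := walk_leave mN; rewrite -pv walk_other // pv' eqxx.
have qN : q < N by apply: ltn_trans mN.
have q1N : q.+1 <= N by [].
have [iq1 iq2] := intact_before qm (leqnn m).
have jm : j m = p q (x q) by rewrite -pv walk_other // iq1.
have jq := walk_leave qN.
have pq1x : p q.+1 (x q.+1) = j q := walk_group qN.
have [kq1 kq2] : intact q.+1 m.+1.
  move: qm; rewrite leq_eqVlt => /orP[/eqP->|qm]; first exact: intact_next.
  apply: intact_step => //; first exact: fresh_token.
    by move=> jm'; move: jq; rewrite -pq1x -jm' jm eqxx.
  exact: intact_before.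
have xmF : x m \notin F q := fresh_token qm (leqnn m).
have [lx lz] := walk_low (ltnW qN); have [exz pz] := walk_edge (ltnW qN).
have zF : z q \in F q.
  rewrite in_setD1 (comp_trans (comp_refl _ _) exz) // andbT.
  by apply: contraTneq exz => ->; rewrite e_irr.
(* The components meet in [v], so the token can walk through [F q] to the former companion [z q]. *)
have czm : z q \in comp (p m.+1) (x m).
  move: vc; rewrite !inE => cxv; apply: connect_trans cxv _.
  apply: connect_induced_sub (state_comp_connect (walk_state (ltnW qN)) vF zF).
  apply/subsetP => w wF; rewrite inE -/(j m) jm walk_other ?iq1 //.
  by apply: contraNneq xmF => <-.
have stm : state (p m.+1) (x m).
  by rewrite walk_step //; apply: state_upd; [apply: walk_state; apply: ltnW|case: (walk_low (ltnW mN))].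
(* Now [z q] enters the group [j q], where [F q.+1] is still intact, and is compared with the token
   [x q.+1] of time [q.+1]. *)
pose p' := upd (p m.+1) (z q) (j q).
have st' : state p' (z q) by apply: state_upd => //; apply: state_move czm.
have p'z : p' (z q) = j q by rewrite /p' upd_same.
have st1 : state (p q.+1) (x q.+1) by apply: walk_state.
have pq1z : p q.+1 (z q) = p q (x q).
  by rewrite walk_other ?pz //; move: zF; rewrite in_setD1 => /andP[].
have zx1 : z q != x q.+1 by apply: contra_neq jq => zx; rewrite -pq1x -zx pq1z.
have zF1 : z q \notin F q.+1.
  by apply: contra jq => /kq1; rewrite pq1x => <-; rewrite walk_other ?iq1 //; apply: contraNneq xmF => <-.
have x1F1 : x q.+1 \notin F q.+1 by rewrite in_setD1 eqxx.
have in_p' w : w \in F q.+1 -> p' w = j q.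
  move=> wF; rewrite /p' upd_other ?kq1 //.
  by apply: contraNneq zF1 => <-.
have compare u : u \in F q.+1 -> u \in comp p' (z q) -> e u (z q) = e u (x q.+1).
  move=> uF uc.
  apply: (compare_tokens st' st1) => //.
  - by rewrite p'z pq1x.
  - by move: uF; rewrite in_setD1 => /andP[].
  - move=> w wz wx euw; rewrite p'z; apply/eqP/eqP => pw.
      have wF : w \in F q.+1.
        by apply: kq2 uF euw _; rewrite pq1x -pw /p' upd_other.
      by move: wF; rewrite in_setD1 => /andP[_ /mem_comp_class->].
    apply: in_p'; rewrite in_setD1 wx; move: uF; rewrite in_setD1 => /andP[_ uc1].
    by apply: comp_trans uc1 euw _; rewrite pw.
  - move=> eux; rewrite p'z; apply: contra x1F1 => /eqP px1; apply: kq2 uF eux _.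
    by rewrite pq1x -px1 /p' upd_other // eq_sym.
  - by move=> _; rewrite p'z pq1z eq_sym.
have xF1 : x q \in F q.+1 := walk_prev qN.
have ezx : e (z q) (x q) by rewrite e_sym.
have xc : x q \in comp p' (z q) by apply: comp_trans (comp_refl _ _) ezx _; rewrite p'z in_p'.
have exx1 : e (x q) (x q.+1) by rewrite -compare.
(* This second neighbour will join [z q] to [x q.+1] inside the group [j q] as it was at time
   [q]. *)
have [u [exu uF ux]] : exists u, [/\ e (x q.+1) u, u \in F q.+1 & u != x q].
  have := state_tight st1; have := gsize_ge2 (p q.+1 (x q.+1)) => + h; rewrite -h.
  rewrite (cardsD1 (x q)) => h2.
  have : 0 < #|nbc (p q.+1) (p q.+1 (x q.+1)) (x q.+1) :\ x q|.
    by move: h2; case: (_ \in _) => //=; apply: ltn_trans.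
  rewrite card_gt0 => /set0Pn[u]; rewrite !in_set in_set1 => /and3P[ux exu /eqP pu].
  exists u; split=> //; rewrite in_setD1 (comp_trans (comp_refl _ _) exu) // andbT.
  by apply: contraTneq exu => ->; rewrite e_irr.
have uc : u \in comp p' (z q).
  move: xc; rewrite !inE => cx; apply: connect_trans cx _.
  apply: connect_induced_sub (state_comp_connect st1 xF1 uF).
  by apply/subsetP => w wF; rewrite inE p'z in_p'.
have ezu : e (z q) u by rewrite e_sym compare // e_sym.
have pu : p q u = j q.
  rewrite -(walk_other qN ux); move: uF; rewrite in_setD1 => /andP[_ /mem_comp_class->] //.
(* Back at time [q], either [z q] or [x q] can be sent to [j q]; comparing the two makes [x q.+1]
   adjacent to both. *)
pose p2 := upd (p q) (z q) (j q).
have p2z : p2 (z q) = j q by rewrite /p2 upd_same.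
have st2 : state p2 (z q).
  apply: state_upd => //; apply: state_move (walk_state (ltnW qN)) _.
  by move: zF; rewrite in_setD1 => /andP[].
have stx : state (p q.+1) (x q).
  by rewrite walk_step //; apply: state_upd => //; apply: walk_state; apply: ltnW.
have nx1x : x q.+1 != x q by apply: contraTneq exx1 => ->; rewrite e_irr.
have pqx1 : p q (x q.+1) = j q by rewrite -pq1x walk_other.
have uz : u != z q by apply: contraTneq ezu => ->; rewrite e_irr.
have x1c2 : x q.+1 \in comp p2 (z q).
  have uc2 : u \in comp p2 (z q).
    by apply: comp_trans (comp_refl _ _) ezu _; rewrite p2z /p2 upd_other.
  by apply: comp_trans uc2 _ _; [rewrite e_sym|rewrite p2z /p2 upd_other // eq_sym].
have x1c : x q.+1 \in comp (p q.+1) (x q) by apply: comp_trans (comp_refl _ _) exx1 _.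
have ex1z : e (x q.+1) (z q) = e (x q.+1) (x q).
  apply: (compare_tokens st2 stx) => //.
  - by apply: contraTneq exz => ->; rewrite e_irr.
  - by move=> w wz wx _; rewrite p2z /p2 upd_other // walk_other.
  - move=> _; rewrite p2z /p2 upd_other; first by rewrite eq_sym.
    by apply: contraTneq exz => ->; rewrite e_irr.
  - by rewrite p2z pq1z eq_sym.
apply: (@walk_bad q (x q.+1)) => //; first by case: (walk_low q1N).
by rewrite e_sym ex1z e_sym.
Qed.

End FirstReturn.

(** The earliest return is excluded by [no_first_return]. Without returns the tokens are distinct:
    [x s] lies in [F s.+1], which no later arrival meets. *)
Lemma walk_short : N < #|T|.
Proof.
rewrite ltnNge; apply/negP => TN.
have [/existsP[s /existsP[q /existsP[v vP]]]|none] := boolP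
  [exists s : 'I_N, [exists q : 'I_s.+1, [exists v, (v \in A s) && (v \in F q)]]].
  pose ret s := (s < N) && [exists q : 'I_s.+1, [exists v, (v \in A s) && (v \in F q)]].
  have ex_ret : exists s, ret s.
    by exists s; rewrite /ret ltn_ord; apply/existsP; exists q; apply/existsP; exists v.
  case: (ex_minnP ex_ret) => m /andP[mN /existsP[q' /existsP[v' /andP[vA vF]]]] minm.
  apply: (no_first_return mN _ _ vA vF); last by rewrite -ltnS.
  move=> s' q0 v0 sm qs v0A; have sN := ltn_trans sm mN; apply/negP => v0F.
  move: sm; rewrite ltnNge => /negP; apply; apply: minm; rewrite /ret sN.
  apply/existsP; exists (Ordinal (qs : q0 < s'.+1)); apply/existsP; exists v0.
  by rewrite v0A.
have fresh s q v : s < N -> q <= s -> v \in A s -> v \notin F q.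
  move=> sN qs vA; apply: contra none => vF; apply/existsP; exists (Ordinal sN).
  by apply/existsP; exists (Ordinal (qs : q < s.+1)); apply/existsP; exists v; rewrite vA.
have new_token s s' : s < s' -> s' <= N -> x s != x s'.
  case: s' => // s'; rewrite ltnS => ss sN; have xA := walk_next sN.
  move: ss; rewrite leq_eqVlt => /orP[/eqP->|ss].
    by move: xA; rewrite in_setD1 eq_sym => /andP[].
  by apply: contraNneq (fresh _ _ _ sN ss xA) => <-; apply: walk_prev; apply: ltn_trans sN.
have inj : injective (fun s : 'I_N.+1 => x s).
  move=> s s' /= xs; apply/val_inj => /=; case: (ltngtP s s') => // ss.
    by have := new_token _ _ ss (ltn_ord s'); rewrite xs eqxx.
  by have := new_token _ _ ss (ltn_ord s); rewrite xs eqxx.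
by have := leq_card _ inj; rewrite card_ord ltnNge TN.
Qed.

End Walk.

(** The triple consists of partition, token and companion. *)
Definition low_pair (s : (T -> P) * T * T) :=
  [/\ state s.1.1 s.1.2, low s.1.2, low s.2, e s.1.2 s.2 & s.1.1 s.2 = s.1.1 s.1.2].

Definition escape (s s' : (T -> P) * T * T) :=
  [/\ s'.1.1 = upd s.1.1 s.1.2 (s'.1.1 s.1.2), s'.1.1 s.1.2 != s.1.1 s.1.2,
      s'.1.2 \in comp s'.1.1 s.1.2 :\ s.1.2 &
      forall y, low y -> s.1.1 y = s'.1.1 s.1.2 -> e s.1.2 y -> e s.2 y -> False].

Definition terminal (s : (T -> P) * T * T) :=
  forall j, j != s.1.1 s.1.2 -> exists y, [/\ low y, s.1.1 y = j, e s.1.2 y & e s.2 y].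

(** The new token must differ from [x], so if [x] is an end of the low edge, the other end is
    taken. *)
Lemma low_pair_exists p x : state p x ->
  exists y z, y \in comp p x :\ x /\ low_pair (p, y, z).
Proof.
move=> st; have [u [v [uc vc euv lu lv]]] := state_low_edge st.
have pu := mem_comp_class uc; have pv := mem_comp_class vc.
have [ux|ux] := eqVneq u x.
  exists v, u; rewrite in_setD1 vc andbT; split.
    by rewrite -ux; apply: contraTneq euv => ->; rewrite e_irr.
  by split=> //=; [apply: state_move vc|rewrite e_sym|rewrite pu pv].
by exists u, v; rewrite in_setD1 ux; split=> //; split=> //=; [apply: state_move uc|rewrite pu pv].
Qed.

Lemma terminal_or_escape s : low_pair s ->
  terminal s \/ exists2 s', low_pair s' & escape s s'.
Proof.
case: s => [[p x] z] lp; case: (lp) => /= st lx lz exz pz.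
case: (pickP [pred j | (j != p x) &&
   ~~ [exists y, [&& low y, p y == j, e x y & e z y]]]) => [j /andP[jx none]|all_j].
  right; have st' : state (upd p x j) x by apply: state_upd.
  have [y [w [yc lp']]] := low_pair_exists st'.
  exists (upd p x j, y, w); first exact: lp'.
  split=> //=; rewrite ?upd_same // => y' ly py exy ezy.
  by case/negP: none; apply/existsP; exists y'; rewrite ly py eqxx exy ezy.
left=> j jx; have := all_j j; rewrite /= in jx; rewrite /= jx => /negbT/negPn/existsP[y].
by move=> /and4P[ly /eqP py exy ezy]; exists y.
Qed.

Lemma terminal_or_walk m s0 : low_pair s0 ->
  (exists2 s, low_pair s & terminal s) \/
  exists f : nat -> (T -> P) * T * T,
    (forall i, i <= m -> low_pair (f i)) /\ (forall i, i < m -> escape (f i) (f i.+1)).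
Proof.
move=> lp0; elim: m => [|m [IH|[f [lpf escf]]]]; [by right; exists (fun=> s0)|by left|].
have [term|[s' lp' esc]] := terminal_or_escape (lpf m (leqnn m)).
  by left; exists (f m); first exact: lpf.
right; exists (fun i => if i <= m then f i else s'); split=> i.
  by rewrite /=; case: ifP => // im _; apply: lpf.
rewrite ltnS leq_eqVlt => /orP[/eqP->|im]; first by rewrite eqxx ltnn.
by rewrite im orbT; apply: escf.
Qed.

(** A walk that meets no terminal state reaches length [#|T|], which [walk_short] forbids. *)
Lemma terminal_exists : (exists c x, proper_off c x) ->
  exists2 s, low_pair s & terminal s.
Proof.
move=> /optimal_exists[c [x0 opt]].
have st : state (g \o c) x0 by exists c.
have [y [z [_ lp]]] := low_pair_exists st.
have [//|[f [lpf escf]]] := terminal_or_walk #|T| lp.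
have := @walk_short (fun i => (f i).1.1) (fun i => (f i).1.2) (fun i => (f i).2) #|T|.
rewrite ltnn => walk; suff : false by []; apply: walk => i.
- by move=> /lpf[].
- by move=> /lpf[].
- by move=> /lpf[].
- by move=> /escf[].
- by move=> /escf[].
- by move=> /escf[].
- by move=> y' /escf[_ _ _]; apply.
Qed.

(** * The neighbourhood of the token at the end of the walk *)

Section TerminalState.
Hypothesis card_C : 3 <= #|C|.
Variables (p : T -> P) (x z : T).
Hypotheses (st : state p x) (low_x : low x) (low_z : low z) (exz : e x z) (pz : p z = p x).
Hypothesis term : terminal (p, x, z).

Let neqx v : e x v -> v != x.
Proof. by move=> exv; apply: contraTneq exv => ->; rewrite e_irr. Qed.

Lemma single_group_clique u v : (forall j, j = p x) -> e x u -> e x v -> u != v -> e u v.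
Proof.
move=> one exu exv uv; apply: (state_brooks st) => //.
suff -> : gsize (p x) = #|C| by [].
by rewrite /gsize; apply: eq_card => a; rewrite !inE; apply/eqP; apply: one.
Qed.

(** The walk has ended, so the group of [v] contains a common neighbour of [x] and [z]; by
    [common_nbr_class] they have the same neighbours there. *)
Lemma partner_other_group v : e x v -> p v != p x -> e z v.
Proof.
move=> exv pv; have [y [ly py exy ezy]] := term pv; rewrite /= in py exy ezy.
by rewrite (common_nbr_class st low_x low_z exz (z := y)) ?py ?pz // neqx.
Qed.

(** Here [x] and [y] are compared through their common neighbour [z]. *)
Lemma low_other_to_own y v : low y -> e x y -> p y != p x -> e x v -> p v = p x -> e y v.
Proof.
move=> ly exy py exv pv.
rewrite (common_nbr_class st low_x ly exy (z := z)) ?pz ?neqx //; first by rewrite eq_sym.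
by rewrite e_sym partner_other_group.
Qed.

Lemma low_own_to_other y v : low y -> e x y -> p y = p x -> e x v -> p v != p x -> e y v.
Proof.
move=> ly exy py exv pv; have [w [lw pw exw ezw]] := term pv; rewrite /= in pw exw ezw.
rewrite (common_nbr_class st low_x ly exy (z := w)) ?pw ?py ?neqx //.
by rewrite e_sym low_other_to_own // pw.
Qed.

(** Hand the token to [y] and compare it, through [x], with a low neighbour [w] from another group,
    which is already known to be adjacent to [v]. *)
Lemma low_own_to_own j y v : j != p x ->
  low y -> e x y -> p y = p x -> e x v -> p v = p x -> v != y -> e y v.
Proof.
move=> jx ly exy py exv pv vy; have [w [lw pw exw ezw]] := term jx; rewrite /= in pw exw ezw.
have pwx : p w != p x by rewrite pw.
have sty : state p y by apply: (state_move st); apply: comp_trans (comp_refl _ _) exy _.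
have eyw : e y w by apply: low_own_to_other.
rewrite -(common_nbr_class sty ly lw eyw (z := x)) ?pv //.
- by apply: low_other_to_own.
- by rewrite eq_sym.
- by rewrite e_sym.
- by rewrite e_sym.
Qed.

(** Put [x] into the group of [y], hand the token to [y], and compare [y] with [z] through [x]. *)
Lemma low_other_same y v :
  low y -> e x y -> p y != p x -> e x v -> p v = p y -> v != y -> e y v.
Proof.
move=> ly exy py exv pv vy.
pose q := upd p x (p y).
have qx : q x = p y by rewrite /q upd_same.
have qo w : e x w -> q w = p w by move=> /neqx wx; rewrite /q upd_other.
have sty : state q y.
  apply: (@state_move _ x); first exact: state_upd.
  by apply: (comp_trans (comp_refl _ _) exy); rewrite qx qo.
have eyz : e y z by rewrite e_sym partner_other_group.
rewrite -(common_nbr_class sty ly low_z eyz (z := x)) ?qx ?qo //.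
- by apply: partner_other_group; rewrite ?pv.
- by rewrite pz.
- by rewrite e_sym.
- by rewrite e_sym.
Qed.

Lemma low_other_to_other y v :
  low y -> e x y -> p y != p x -> e x v -> p v != p x -> p v != p y -> e y v.
Proof.
move=> ly exy py exv pv pvy; have [w [lw pw exw ezw]] := term pv; rewrite /= in pw exw ezw.
suff eyw : e y w by rewrite (common_nbr_class st low_x ly exy (z := w)) ?pw ?neqx.
have [u [exu pu uz]] : exists u, [/\ e x u, p u = p x & u != z].
  have := gsize_ge2 (p x); rewrite -(state_tight st) => /card_gt1P[a [b []]].
  rewrite !inE => /andP[exa /eqP pa] /andP[exb /eqP pb] ab.
  by have [az|az] := eqVneq a z; [exists b; rewrite -az eq_sym|exists a].
have eyz : e y z by rewrite e_sym partner_other_group.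
have ezu : e z u by apply: (low_own_to_own py).
have ewu : e w u by apply: low_other_to_own; rewrite ?pw.
(* The token goes from [x] to [y], which is put into the old group of [x], and on to [z]. Now [y]
   and [u] share a group, and comparing [z] with [w] through [u] gives the edge from [y] to [w]. *)
pose q1 := upd p x (p y); pose q := upd q1 y (p x).
have st1 : state q1 y.
  apply: (@state_move _ x); first exact: state_upd.
  by apply: (comp_trans (comp_refl _ _) exy); rewrite /q1 upd_same upd_other // neqx.
have qy : q y = p x by rewrite /q upd_same.
have qo a : e x a -> a != y -> q a = p a.
  by move=> /neqx ax ay; rewrite /q /q1 !upd_other.
have neqy a : p a != p y -> a != y by apply: contra_neq => ->.
have zy : z != y by apply: neqy; rewrite pz eq_sym.
have uy : u != y by apply: neqy; rewrite pu eq_sym.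
have wy : w != y by apply: neqy; rewrite pw.
have st2 : state q z.
  apply: (@state_move _ y); first exact: state_upd.
  by apply: (comp_trans (comp_refl _ _) eyz); rewrite qy qo.
rewrite e_sym (common_nbr_class st2 low_z lw ezw (z := u)) //.
- by rewrite e_sym.
- by rewrite !qo // pu pw eq_sym.
- by rewrite eq_sym.
- by rewrite qy qo.
Qed.

Lemma low_nbr_adjacent u v : low u -> e x u -> e x v -> u != v -> e u v.
Proof.
move=> lu exu exv uv; have vu : v != u by rewrite eq_sym.
case: (pickP [pred j | j != p x]) => [j /= jx|one]; last first.
  by apply: single_group_clique => // j; apply/eqP; exact: negbFE (one j).
have [pu|pu] := eqVneq (p u) (p x); have [pv|pv] := eqVneq (p v) (p x).
- exact: (low_own_to_own jx).
- exact: low_own_to_other.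
- exact: low_other_to_own.
- have [puv|puv] := eqVneq (p v) (p u); first exact: low_other_same.
  exact: low_other_to_other.
Qed.

(** With a low neighbour [w] in the same group, that group has at least three colours. Once the
    token is put there, Brooks' argument makes [u] and [v] adjacent, but high vertices are
    independent. *)
Lemma high_nbr_inj u v : ~~ low u -> ~~ low v -> e x u -> e x v -> p u = p v -> u = v.
Proof.
move=> hu hv exu exv puv; apply/eqP/negPn/negP => uv.
have [w [lw exw pw]] : exists w, [/\ low w, e x w & p w = p u].
  have [pu|pu] := eqVneq (p u) (p x); first by exists z; rewrite pz.
  by have [w [lw pw exw _]] := term pu; exists w.
have wu : w != u by apply: contraTneq lw => ->.
have wv : w != v by apply: contraTneq lw => ->.
suff euv : e u v.
  by have := high_independent euv; rewrite -/(low u) -/(low v) (negPf hu) (negPf hv).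
have st' : state (upd p x (p u)) x by apply: state_upd.
apply: (state_brooks st'); rewrite ?upd_same ?upd_other ?neqx //.
rewrite -(state_low_tight _ st low_x).
have <- : #|[set u; v; w]| = 3.
  by rewrite -setUA cardsU1 cards2 !inE (eq_sym v) wv negb_or uv (eq_sym u) wu.
apply/subset_leq_card/subsetP => a; rewrite !inE => /orP[/orP[]|] /eqP->.
- by rewrite exu eqxx.
- by rewrite exv puv eqxx.
- by rewrite exw pw eqxx.
Qed.

Lemma terminal_degree : deg e x = #|C|.
Proof.
rewrite -(sum_nbc p) -sum_gsize; apply: eq_bigr => j _; exact: state_low_tight.
Qed.

(** * Recolouring a closed neighbourhood that is not a clique *)

Variable t : nat.
Hypotheses (card_P : #|P| = t.+1) (deg_le : forall v, deg e v <= #|C| + t).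
Hypothesis card_C5 : 5 * t <= #|C|.

Lemma closed_nbhd_clique : exists2 K, is_clique e K & #|K| = #|C|.+1.
Proof.
pose N := [set y | e x y]; pose K := x |: N.
have xN : x \notin N by rewrite inE e_irr.
have cardK : #|K| = #|C|.+1 by rewrite cardsU1 xN -terminal_degree.
pose H := [set u in N | ~~ low u].
have KP v : v \in K -> v = x \/ e x v by rewrite !inE => /orP[/eqP|]; [left|right].
have lowK u v : low u -> u \in K -> v \in K -> u != v -> e u v.
  move=> lu /KP[ux|exu] /KP[vx|exv] uv.
  - by rewrite ux vx eqxx in uv.
  - by rewrite ux.
  - by rewrite vx e_sym.
  - exact: low_nbr_adjacent.
have [H1|] := leqP #|H| 1.
  exists K => //; apply/forallP => u; apply/implyP => uK; apply/forallP => v.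
  apply/implyP => vK; apply/implyP => uv.
  have [lu|hu] := boolP (low u); first exact: lowK.
  have [lv|hv] := boolP (low v); first by rewrite e_sym; apply: lowK; rewrite // eq_sym.
  have hH w : ~~ low w -> w \in K -> w \in H.
    move=> hw /KP[wx|exw]; first by rewrite wx low_x in hw.
    by rewrite !inE exw.
  by move/card_le1_eqP: H1 => /(_ u v (hH _ hu uK) (hH _ hv vK)) uv'; rewrite uv' eqxx in uv.
move=> /card_gt1P[h1 [h2 [h1H h2H h12]]]; exfalso.
have HK : H \subset K by apply/subsetP => v; rewrite !inE => /andP[-> _]; rewrite orbT.
have cardH : #|H| <= t.+1.
  rewrite -card_P -(card_in_imset (f := p) (D := mem H)) ?max_card // => u v.
  by rewrite !inE => /andP[exu hu] /andP[exv hv]; apply: high_nbr_inj.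
have lowL v : v \in K :\: H -> low v.
  rewrite in_setD => /andP[vH /KP[->//|exv]]; apply: contraR vH => hv; by rewrite !inE exv.
pose L := K :\: H.
have cardL : #|L| + #|H| = #|C|.+1.
  by rewrite -cardK -(cardsID H K) (setIidPr HK) addnC.
have LH h : h \in H -> L \subset [set y | e h y].
  move=> hH; apply/subsetP => u uL; rewrite inE e_sym; apply: lowK; first exact: lowL.
  - by move: uL; rewrite in_setD => /andP[].
  - exact: (subsetP HK).
  - by apply: contraTneq uL => ->; rewrite in_setD hH.
pose out h := [set y | e h y] :\: L.
have outE h w : (w \in out h) = (w \notin L) && e h w.
  by rewrite in_setD [w \in [set y | _]]in_set.
have card_out h : h \in H -> #|out h| + #|L| <= #|C| + t.
  move=> hH; rewrite addnC -[X in X + _](_ : #|[set y | e h y] :&: L| = _).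
    by rewrite cardsID; apply: deg_le.
  by rewrite (setIidPr (LH h hH)).
have [c [okc _] cp] := st.
(* Since [#|L| = #|C| + 1 - #|H|] and [#|H| <= t + 1], each of [h1], [h2] has at most [2 * t]
   neighbours outside [L]; and [4 * t < #|C|], for [t = 0] too as [#|C| >= 3]. *)
have [a aO] : exists a, a \notin c @: (out h1 :|: out h2).
  apply/existsP; rewrite -negb_forall; apply/negP => /forallP all_a.
  have : #|C| <= #|c @: (out h1 :|: out h2)|.
    by apply/subset_leq_card/subsetP => a _; apply: all_a.
  have := leq_imset_card c (out h1 :|: out h2).
  have [+ _] := leq_card_setU (out h1) (out h2).
  have := card_out _ h1H; have := card_out _ h2H.
  move: card_C card_C5 cardL cardH; clear.
  lia.
pose c1 v := if (v == h1) || (v == h2) then a else c v.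
have h1high : ~~ low h1 by move: h1H; rewrite inE => /andP[].
have h2high : ~~ low h2 by move: h2H; rewrite inE => /andP[].
have half u v : e u v -> v \notin L -> (u == h1) || (u == h2) ->
    ~~ ((v == h1) || (v == h2)) -> c1 u != c1 v.
  move=> euv vL uh vh; rewrite /c1 uh (negPf vh); apply: contra aO => /eqP ->.
  apply/imset_f; rewrite in_setU !outE vL.
  by case/orP: uh => /eqP <-; rewrite euv ?orbT.
have ok1 u v : e u v -> u \notin L -> v \notin L -> c1 u != c1 v.
  move=> euv uL vL; have [uh|uh] := boolP ((u == h1) || (u == h2));
    have [vh|vh] := boolP ((v == h1) || (v == h2)).
  - have hu : ~~ low u by case/orP: uh => /eqP->.
    have hv : ~~ low v by case/orP: vh => /eqP->.
    by have := high_independent euv; rewrite -/(low u) -/(low v) (negPf hu) (negPf hv).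
  - exact: half.
  - by rewrite eq_sym; apply: half; rewrite // e_sym.
  - rewrite /c1 (negPf uh) (negPf vh); apply: okc => //.
      by apply: contraNneq uL => ->; rewrite !inE eqxx low_x e_irr.
    by apply: contraNneq vL => ->; rewrite !inE eqxx low_x e_irr.
(* As [h1] and [h2] share a colour, at least [#|L|] colours are absent from [H]. *)
pose U := c1 @: H.
have cardU : #|U| < #|H|.
  rewrite ltn_neqAle leq_imset_card andbT; apply/negP => /imset_injP inj.
  by case/negP: h12; apply/eqP; apply: inj; rewrite // /c1 !eqxx orbT.
pose free := ~: U.
have cardLF : #|L| <= #|free|.
  by have := cardsC U; rewrite -/free; move: cardU cardL; clear; lia.
(* Distinct free colours for [L]; there the default [a] never occurs. *)
pose phi u := nth a (enum free) (index u (enum L)).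
have idx u : u \in L -> index u (enum L) < size (enum free).
  by move=> uL; rewrite -cardE; apply: leq_trans cardLF; rewrite cardE index_mem mem_enum.
have phiF u : u \in L -> phi u \in free by move=> uL; rewrite -mem_enum mem_nth ?idx.
have phi_inj u v : u \in L -> v \in L -> phi u = phi v -> u = v.
  move=> uL vL /eqP; rewrite nth_uniq ?idx ?enum_uniq // => /eqP.
  by apply: (@index_inj _ u (enum L)); rewrite mem_enum.
pose c2 v := if v \in L then phi v else c1 v.
have half2 u v : e u v -> u \in L -> v \notin L -> c2 u != c2 v.
  move=> euv uL vL; rewrite /c2 uL (negPf vL).
  have uK : u \in K by move: uL; rewrite in_setD => /andP[].
  have sub : K :\ u \subset [set y | e u y].
    apply/subsetP => w; rewrite in_setD1 => /andP[wu wK]; rewrite inE.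
    by apply: lowK; rewrite ?lowL // eq_sym.
  (* A low vertex has at most [#|C| = #|K| - 1] neighbours, hence none outside [K]. *)
  have eqN : K :\ u = [set y | e u y].
    apply/eqP; rewrite eqEcard sub /=.
    have := cardsD1 u K; rewrite uK cardK add1n => -[<-].
    exact: (lowL _ uL).
  have vH : v \in H.
    have : v \in K :\ u by rewrite eqN inE.
    rewrite in_setD1 => /andP[_ vK]; apply: contraR vL => vH; by rewrite in_setD vH.
  apply: contraTneq (phiF u uL) => ->; rewrite in_setC negbK; exact: imset_f.
case: not_colourable; exists c2 => u v euv.
have [uL|uL] := boolP (u \in L); have [vL|vL] := boolP (v \in L).
- rewrite /c2 uL vL; apply: contraTneq euv => /(phi_inj u v uL vL) ->; by rewrite e_irr.
- exact: half2.
- by rewrite eq_sym; apply: half2; rewrite // e_sym.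
- by rewrite /c2 (negPf uL) (negPf vL); apply: ok1.
Qed.

End TerminalState.
End GroupedColourings.

(** * The bound *)

Lemma token_colouring_clique (T : finType) (e : rel T) (n t : nat) :
  symmetric e -> irreflexive e -> 3 <= n -> 5 * t <= n ->
  (forall v, deg e v <= n + t) ->
  (forall u v, e u v -> (deg e u <= n) || (deg e v <= n)) ->
  ~ (exists c : T -> 'I_n, forall u v, e u v -> c u != c v) ->
  (exists (c : T -> 'I_n) x, proper_off e c x) ->
  exists2 K, is_clique e K & #|K| = n.+1.
Proof.
move=> e_sym e_irr n3 n5 deg_le high_ind ncol part.
(* Group [j] contains the colours [j] and [j + t + 1], the larger being at most [2 * t + 1 < n]. *)
pose g (a : 'I_n) : 'I_t.+1 := inord (a %% t.+1).
have g2 j : 2 <= gsize g j.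
  have jn : j < n by have := ltn_ord j; lia.
  have jtn : j + t.+1 < n by have := ltn_ord j; lia.
  apply/card_gt1P; exists (Ordinal jn), (Ordinal jtn); split.
  - by rewrite inE /g /= modn_small ?inord_val.
  - by rewrite inE /g /= modnDr modn_small ?inord_val.
  - by rewrite -val_eqE /=; lia.
have db x : deg e x < #|'I_n| + #|'I_t.+1| by rewrite !card_ord addnS ltnS.
have hi u v : e u v -> (deg e u <= #|'I_n|) || (deg e v <= #|'I_n|).
  by rewrite card_ord; apply: high_ind.
have [[[p x] z] [/= st lx lz exz pz] term] := terminal_exists e_sym e_irr ncol g2 db hi part.
have [||||K cK] := closed_nbhd_clique e_sym e_irr ncol g2 db hi _ st lx lz exz pz term (t := t).
- by rewrite card_ord.
- by rewrite card_ord.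
- by move=> v; rewrite card_ord.
- by rewrite card_ord.
by rewrite card_ord; exists K.
Qed.

Lemma not_colourable_clique (T : finType) (e : rel T) (n t : nat) :
  symmetric e -> irreflexive e -> 3 <= n -> 5 * t <= n ->
  (forall v, deg e v <= n + t) ->
  (forall u v, e u v -> (deg e u <= n) || (deg e v <= n)) ->
  ~~ colorable e n -> exists2 K, is_clique e K & #|K| = n.+1.
Proof.
move=> e_sym e_irr n3 n5 deg_le high_ind ncol.
pose col (S : {set T}) := [exists f : {ffun T -> 'I_n},
  [forall u in S, forall v in S, e u v ==> (f u != f v)]].
have ncolT : ~~ col [set: T].
  apply: contra ncol => /existsP[f /forallP fP]; apply/existsP; exists f.
  apply/forallP => u; apply/forallP => v.
  by have := fP u; rewrite inE => /forallP/(_ v); rewrite inE.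
(* In a smallest vertex set that is not [n]-colourable, deleting a vertex leaves the partial
   colouring that the token needs. *)
case: (@arg_minnP _ [set: T] (fun S => ~~ col S) (fun S => #|S|) ncolT) => S nS minS.
have n0 : 0 < n by apply: leq_trans n3.
have [x xS] : exists x, x \in S.
  apply/set0Pn; apply: contra nS => /eqP->; apply/existsP; exists [ffun=> Ordinal n0].
  by apply/forallP => u; rewrite inE.
have [f fP] : exists f : {ffun T -> 'I_n}, forall u v,
    u \in S :\ x -> v \in S :\ x -> e u v -> f u != f v.
  have : col (S :\ x).
    apply: contraT => /minS; rewrite (cardsD1 x S) xS; lia.
  move=> /existsP[f /forallP fP]; exists f => u v uS vS euv.
  by have := fP u; rewrite uS => /forallP/(_ v); rewrite vS euv.
pose U := {u : T | u \in S}; pose eU : rel U := fun u v => e (val u) (val v).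
have degU (u : U) : deg eU u <= deg e (val u).
  rewrite /deg -(card_imset (f := val) _ val_inj); apply/subset_leq_card/subsetP => w.
  by case/imsetP => y; rewrite !inE => euy ->.
have [||||||K cK cardK] := @token_colouring_clique U eU n t _ _ n3 n5.
- by move=> u v; apply: e_sym.
- by move=> u; apply: e_irr.
- by move=> v; apply: leq_trans (degU v) (deg_le _).
- by move=> u v /high_ind /orP[] h; apply/orP; [left|right]; apply: leq_trans (degU _) h.
- case=> c cP; case/negP: nS; apply/existsP.
  exists [ffun v => if insub v is Some u then c u else Ordinal n0].
  apply/forallP => u; apply/implyP => uS; apply/forallP => v; apply/implyP => vS.
  by apply/implyP => euv; rewrite !ffunE !insubT; apply: cP.
- exists (fun u => f (val u)), (exist _ x xS) => u v ux vx.
  have memS (w : U) : w != exist _ x xS -> val w \in S :\ x.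
    by rewrite -val_eqE in_setD1 => -> /=; apply: (valP w).
  by apply: fP; apply: memS.
exists (val @: K); last by rewrite card_imset //; apply: val_inj.
apply/forallP => u; apply/implyP => /imsetP[u' uK ->].
apply/forallP => v; apply/implyP => /imsetP[v' vK ->]; apply/implyP => uv.
have := forallP cK u'; rewrite uK => /forallP/(_ v'); rewrite vK => /= /implyP; apply.
by apply: contra uv => /eqP->.
Qed.

Lemma chromatic_number_not_colorable (T : finType) (e : rel T) n :
  n < chromatic_number e -> ~~ colorable e n.
Proof.
move=> nchi; apply/negP => coln; move: nchi; rewrite ltnNge => /negP; apply.
have chiT : chromatic_number e <= #|T|.
  by rewrite /chromatic_number; elim/big_rec: _ => // i m _; rewrite geq_min orbC => ->.
(* For [n > #|T|] the index is out of range, but the minimum never exceeds its default [#|T|]. *)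
have [nT|Tn] := ltnP n #|T|.+1; last by apply: leq_trans chiT (ltnW Tn).
rewrite /chromatic_number; have := mem_index_enum (Ordinal nT).
elim: (index_enum _) => // k r IH; rewrite in_cons big_cons => /orP[/eqP<-|/IH le_n] /=.
  by rewrite coln geq_minl.
by case: ifP => // _; rewrite geq_min le_n orbT.
Qed.

Import Order.TTheory GRing.Theory Num.Theory.
Local Open Scope ring_scope.

Theorem mainTheorem1 (T : finType) (e : rel T)
  (e_sym : symmetric e) (e_irr : irreflexive e)
  (hD : (3 <= maxdeg e)%N) :
  ((chromatic_number e)%:R : rat)
    <= Num.max ((clique_number e)%:R)
         (Num.max ((Delta2 e)%:R) ((5%:R / 6%:R) * ((maxdeg e).+1)%:R)).
Proof.
rewrite leNgt; apply/negP; rewrite !gt_max !ltr_nat => /and3P[omega_lt Delta2_lt].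
rewrite mulrAC ltr_pdivrMr // -!natrM ltr_nat => Delta_lt.
case def_chi: (chromatic_number e) => [|n] in omega_lt Delta2_lt Delta_lt; first by [].
(* [Delta_lt] now amounts to [5 * maxdeg e <= 6 * n]; it yields [n >= 3] here and the degree bound
   [n + n %/ 5] below. *)
have n3 : (3 <= n)%N by lia.
have ncol : ~~ colorable e n by apply: chromatic_number_not_colorable; rewrite def_chi.
have [|||K cK cardK] := @not_colourable_clique T e n (n %/ 5) e_sym e_irr n3 _ _ _ ncol.
- by rewrite mulnC leq_divM.
- move=> v; have : (deg e v <= maxdeg e)%N by apply: (leq_bigmax (F := deg e)).
  lia.
- move=> u v euv; rewrite -geq_min -ltnS; apply: leq_ltn_trans Delta2_lt.
  apply: leq_trans (leq_bigmax (F := fun x => \max_(y | e x y) minn (deg e x) (deg e y)) u).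
  exact: (leq_bigmax_cond (F := fun y => minn (deg e u) (deg e y))).
by move: omega_lt; rewrite ltnS leqNgt -cardK (leq_bigmax_cond (F := fun K : {set T} => #|K|)).
Qed.
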